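(* Let $\Omega=\{1,\dots,d\}^{\mathbb N}$ with the shift $\sigma$, and let $A:\Omega\to\mathbb R$ be Lipschitz continuous. Assume that there is a unique $A$-maximizing measure. Then all the calibrated subactions for $A$ are equal up to an additive constant.
   Context: $\Omega$ carries the metric $d(x,y)=2^{-\min\{n:\ x_n\ne y_n\}}$ and $\sigma(x_0x_1x_2\ldots)=x_1x_2\ldots$. $m(A)=\max\int A\,d\nu$ over $\sigma$-invariant Borel probability measures $\nu$ on $\Omega$; a $\sigma$-invariant probability $\mu$ is $A$-maximizing if $\int A\,d\mu=m(A)$. A calibrated subaction for $A$ is a continuous $u:\Omega\to\mathbb R$ with $u(x)=\max_{\sigma(y)=x}[A(y)+u(y)-m(A)]$ for all $x\in\Omega$. *)

(* Defs.v *)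
From HB Require Import structures.
From mathcomp Require Import all_boot all_order all_algebra.
From mathcomp Require Import all_classical all_reals all_analysis.

Set Implicit Arguments.
Unset Strict Implicit.
Unset Printing Implicit Defensive.

Import Order.TTheory GRing.Theory Num.Theory.
Import numFieldNormedType.Exports.

Local Open Scope classical_set_scope.
Local Open Scope ring_scope.

(* The alphabet {1, ..., d} is 'I_n.+1 with d = n.+1.  The parameter [R] is the
   field in which the distance takes its values; it occurs in the type so that
   the metric structure below can be inferred. *)
Definition Omega (R : realType) (n : nat) : Type := nat -> 'I_n.+1.

Section Omega_metric.
Context {R : realType} {n : nat}.
Implicit Types x y z : Omega R n.

Definition Omega_dist x y : R :=
  if pselect (exists i, x i != y i) is left xy then 2 ^- ex_minn xy else 0.

Lemma Omega_dist_ge0 x y : 0 <= Omega_dist x y.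
Proof. by rewrite /Omega_dist; case: pselect => // h; rewrite invr_ge0 exprn_ge0. Qed.

Lemma Omega_dist_ge x y i : x i != y i -> 2 ^- i <= Omega_dist x y.
Proof.
move=> xyi; rewrite /Omega_dist; case: pselect => [h|[]]; last by exists i.
case: ex_minnP => j _ /(_ i xyi) ji.
by rewrite lef_pV2 ?posrE ?exprn_gt0// ler_eXn2l ?ltr1n.
Qed.

Lemma Omega_distxx x : Omega_dist x x = 0.
Proof.
rewrite /Omega_dist; case: pselect => // h; exfalso.
by case: h => i; rewrite eqxx.
Qed.

Lemma Omega_dist_positivity x y : Omega_dist x y = 0 -> x = y.
Proof.
move=> xy0; apply/funext => i; apply/eqP/negPn/negP => /Omega_dist_ge.
by rewrite xy0 leNgt invr_gt0 exprn_gt0.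
Qed.

Lemma Omega_dist_sym x y : Omega_dist x y = Omega_dist y x.
Proof.
suff le x' y' : Omega_dist x' y' <= Omega_dist y' x'.
  by apply/eqP; rewrite eq_le !le.
rewrite {1}/Omega_dist; case: pselect => [h|_]; last exact: Omega_dist_ge0.
by case: ex_minnP => i xyi _; apply: Omega_dist_ge; rewrite eq_sym.
Qed.

Lemma Omega_dist_triangle y x z :
  Omega_dist x z <= Omega_dist x y + Omega_dist y z.
Proof.
rewrite {1}/Omega_dist; case: pselect => [h|_]; last first.
  by rewrite addr_ge0 ?Omega_dist_ge0.
case: ex_minnP => i xzi _; have [xyi|xyi] := eqVneq (x i) (y i).
  by rewrite ler_wpDl ?Omega_dist_ge0 ?Omega_dist_ge// -xyi.
by rewrite ler_wpDr ?Omega_dist_ge0 ?Omega_dist_ge.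
Qed.

End Omega_metric.

HB.instance Definition _ (R : realType) (n : nat) :=
  Choice.copy (Omega R n) (nat -> 'I_n.+1).
HB.instance Definition _ (R : realType) (n : nat) :=
  isPointed.Build (Omega R n) (fun=> ord0).
HB.instance Definition _ (R : realType) (n : nat) :=
  isMetric.Build R (Omega R n) (@Omega_distxx R n) (@Omega_dist_positivity R n)
    (@Omega_dist_sym R n) (@Omega_dist_triangle R n).

Definition Omega_borel (R : realType) (n : nat) :=
  g_sigma_algebraType (@open (Omega R n)).

Definition Omega_shift (R : realType) (n : nat) (x : Omega R n) : Omega R n :=
  fun i => x i.+1.

Definition is_maximum (R : realType) (S : set R) (v : R) : Prop :=
  S v /\ ubound S v.

Lemma is_maximum_sup (R : realType) (S : set R) (v : R) :
  is_maximum S v -> sup S = v.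
Proof.
move=> [Sv ubv]; apply/eqP; rewrite eq_le; apply/andP; split.
  by apply: ge_sup => //; exists v.
by apply: ub_le_sup => //; exists v.
Qed.

Section ergodic_optimization.
Context {R : realType} {n : nat}.
Implicit Types (A u : Omega R n -> R) (mu nu : probability (Omega_borel R n) R).

(* The library's [lipschitz] requires a normed module as domain. *)
Definition lipschitz_continuous A : Prop :=
  exists k : R, forall x y, `|A x - A y| <= k * mdist x y.

Definition shift_invariant mu : Prop :=
  forall B : set (Omega_borel R n), measurable B ->
    mu (@Omega_shift R n @^-1` B) = mu B.

(* For continuous [A] the supremum is attained, and it is then the maximum by
   [is_maximum_sup]. *)
Definition max_integral A : R :=
  sup [set \int[nu]_x A x | nu in [set nu | shift_invariant nu]].

Definition maximizing A mu : Prop :=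
  shift_invariant mu /\ \int[mu]_x A x = max_integral A.

(* A term of type [probability] also carries values at non-measurable sets, so
   measures are compared on measurable sets and not by Leibniz equality. *)
Definition unique_maximizing A : Prop :=
  exists2 mu, maximizing A mu &
    forall nu, maximizing A nu ->
      forall B : set (Omega_borel R n), measurable B -> nu B = mu B.

Definition calibrated_subaction A u : Prop :=
  continuous u /\
  forall x, is_maximum
    [set A y + u y - max_integral A | y in [set y | Omega_shift y = x]] (u x).

End ergodic_optimization.

(* Main.v *)
Require Import Defs.
From HB Require Import structures.
From mathcomp Require Import all_boot all_order all_algebra.
From mathcomp Require Import all_classical all_reals all_analysis.
From mathcomp Require Import ring lra.

(* Fix a calibrated subaction u and a point x, and choose successively preimages
   realising the maximum in the calibration equation.  Along this backward orbit the
   averages of A telescope and tend to m(A), so any limit of the empirical measures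
   is invariant and maximizing, hence is the unique maximizing measure mu.  The
   backward orbit therefore visits every cylinder of positive mu-measure, i.e. it
   accumulates at every point p of the support of mu.  If v is another calibrated
   subaction, u - v is nondecreasing along the orbit, so that
   (u - v)(x) <= (u - v)(p).  Exchanging u and v gives equality.

   The limit of the empirical measures is taken along an ultrafilter: this gives a
   finitely additive function on all subsets, whose restriction to the clopen sets
   is countably additive by compactness and extends by Caratheodory's theorem. *)

Set Implicit Arguments.
Unset Strict Implicit.
Unset Printing Implicit Defensive.

Import Order.TTheory GRing.Theory Num.Theory.
Import numFieldNormedType.Exports.

Local Open Scope classical_set_scope.
Local Open Scope ring_scope.

Section cylinders.
Context {R : realType} {n : nat}.
Implicit Types (x y z : Omega R n) (B C : set (Omega R n)).

Definition agree N x y := forall i, (i < N)%N -> x i = y i.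

Definition cylinder x N : set (Omega R n) := [set y | agree N x y].

Definition clopen_depth N B := forall x y, agree N x y -> B x -> B y.

Lemma agree_refl N x : agree N x x. Proof. by []. Qed.

Lemma agree_sym N x y : agree N x y -> agree N y x.
Proof. by move=> xy i iN; rewrite xy. Qed.

Lemma agree_trans N y x z : agree N x y -> agree N y z -> agree N x z.
Proof. by move=> xy yz i iN; rewrite xy// yz. Qed.

Lemma agreeW M N x y : (M <= N)%N -> agree N x y -> agree M x y.
Proof. by move=> MN xy i iM; apply: xy; exact: leq_trans MN. Qed.

Lemma clopen_depth_cylinder x N : clopen_depth N (cylinder x N).
Proof. by move=> y z yz xy; exact: agree_trans yz. Qed.

Lemma clopen_depthW M N B : (M <= N)%N -> clopen_depth M B -> clopen_depth N B.
Proof. by move=> MN BM x y /(agreeW MN); exact: BM. Qed.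

Lemma clopen_depthC N B : clopen_depth N B -> clopen_depth N (~` B).
Proof. by move=> BN x y /agree_sym xy + By; apply; exact: BN By. Qed.

Lemma clopen_depthI N B C :
  clopen_depth N B -> clopen_depth N C -> clopen_depth N (B `&` C).
Proof. by move=> BN CN x y xy [Bx Cx]; split; [exact: BN Bx|exact: CN Cx]. Qed.

Lemma agree_mdist N x y : (mdist x y < 2 ^- N) <-> agree N.+1 x y.
Proof.
split.
  move=> xyN i iN; apply/eqP/negPn/negP => /(@Omega_dist_ge R) => h.
  have := le_lt_trans h xyN.
  by rewrite ltf_pV2 ?posrE ?exprn_gt0// ltr_eXn2l ?ltr1n// ltnNge -ltnS iN.
move=> xy; rewrite /mdist/= /Omega_dist; case: pselect => [h|_]; last first.
  by rewrite invr_gt0 exprn_gt0.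
case: ex_minnP => i xyi _; rewrite ltf_pV2 ?posrE ?exprn_gt0// ltr_eXn2l ?ltr1n//.
by rewrite ltnNge -ltnS; apply/negP => iN; move: xyi; rewrite xy// eqxx.
Qed.

Lemma nbhs_cylinder x N : nbhs x (cylinder x N).
Proof.
apply/nbhs_ballP; exists (2 ^- N) => /=; first by rewrite invr_gt0 exprn_gt0.
by move=> y; rewrite ballEmdist/= => /agree_mdist; exact: agreeW.
Qed.

Lemma exp2V_lt (e : R) : 0 < e -> exists N, 2 ^- N < e.
Proof.
move=> e0; have [N _ /(_ N (leqnn N))/= h] := near_infty_natSinv_expn_lt (PosNum e0).
exists N; move: h; rewrite div1r; exact.
Qed.

Lemma nbhs_sub_cylinder x B : nbhs x B -> exists N, cylinder x N `<=` B.
Proof.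
move=> /nbhs_ballP[e /= /exp2V_lt[N Ne] xeB]; exists N.+1 => y /agree_mdist xy.
by apply: xeB; rewrite ballEmdist/=; exact: lt_trans Ne.
Qed.

Lemma open_clopen_depth N B : clopen_depth N B -> open B.
Proof.
move=> BN; rewrite openE => x Bx; apply: filterS (nbhs_cylinder x N) => y xy.
exact: BN Bx.
Qed.

(* Otherwise Koenig's lemma yields a point none of whose cylinders is good. *)
Lemma cylinder_compactness (good : set (Omega R n) -> Prop) :
    good set0 -> (forall B C, good B -> good C -> good (B `|` C)) ->
    (forall x, exists N, good (cylinder x N)) ->
  good setT.
Proof.
move=> good0 goodU good_cyl; apply: contrapT => badT.
have extend N x : exists y, ~ good (cylinder x N) ->
    agree N x y /\ ~ good (cylinder y N.+1).
  have [|bad] := pselect (good (cylinder x N)); first by exists x.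
  have {bad} : ~ good (\big[setU/set0]_(a : 'I_n.+1)
      cylinder (fun i => if i == N then a else x i) N.+1).
    apply: contra_not bad; rewrite -bigcup_seq; congr good.
    apply/seteqP; split => [y [a _ ay] i iN|y xy].
      by have := ay i (ltnW iN); rewrite /= ltn_eqF.
    exists (y N); first by rewrite /= mem_index_enum.
    move=> i; rewrite ltnS leq_eqVlt; case: eqP => [->//|_ /= iN].
    exact: xy.
  have [[a bad _]|gd []] := pselect (exists a : 'I_n.+1,
      ~ good (cylinder (fun i => if i == N then a else x i) N.+1)).
    by exists (fun i => if i == N then a else x i) => _; split => // i iN /=;
      rewrite ltn_eqF.
  apply: big_ind => // a _; apply: contrapT => bad; apply: gd; by exists a.
pose f N := projT1 (choice (extend N)).
have fP N : forall x, _ := projT2 (choice (extend N)).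
pose X := fix X k : Omega R n := if k is k'.+1 then f k' (X k') else point.
have badX k : ~ good (cylinder (X k) k).
  elim: k => [|k IH] /=; last by have [] := fP k (X k) IH.
  by apply: contra_not badT; congr good; apply/seteqP; split.
have Xlim k : agree k (fun i => X i.+1 i) (X k).
  elim: k => // k IH i; rewrite ltnS leq_eqVlt => /predU1P[->//|ik].
  by rewrite (IH _ ik); have [/(_ i ik)] := fP k (X k) (badX k).
have [N] := good_cyl (fun i => X i.+1 i).
apply: contra_not (badX N); congr good; apply/seteqP; split => y.
  exact: agree_trans (agree_sym (Xlim N)).
exact: agree_trans (Xlim N).
Qed.

End cylinders.

(* A copy of [Omega R n] whose measurable sets are the clopen sets. *)
Definition clopen_space (R : realType) (n : nat) : Type := Omega R n.

HB.instance Definition _ (R : realType) (n : nat) :=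
  Pointed.copy (clopen_space R n) (Omega R n).

Definition clopen_set (R : realType) (n : nat) (B : set (clopen_space R n)) :=
  exists N, @clopen_depth R n N B.

Section clopen_algebra.
Context {R : realType} {n : nat}.

Let clopen0 : @clopen_set R n set0.
Proof. by exists 0%N. Qed.

Let clopenU : setU_closed (@clopen_set R n).
Proof.
move=> B C [M BM] [N CN]; exists (maxn M N) => x y xy [Bx|Cx].
  by left; apply: BM Bx; apply: agreeW xy; exact: leq_maxl.
by right; apply: CN Cx; apply: agreeW xy; exact: leq_maxr.
Qed.

Let clopenC : setC_closed (@clopen_set R n).
Proof. by move=> B [N BN]; exists N; exact: clopen_depthC. Qed.

Definition clopen_display : measure_display. Proof. exact. Qed.

HB.instance Definition _ := isAlgebraOfSets.Build clopen_display
  (clopen_space R n) clopen0 clopenU clopenC.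

Lemma open_sigma_clopen (B : set (Omega R n)) : open B ->
  <<s @clopen_set R n >> B.
Proof.
move=> oB; have -> : B = \bigcup_N [set x | cylinder x N `<=` B].
  apply/seteqP; split => [x Bx|x [N _]]; last by apply; exact: agree_refl.
  move: oB; rewrite openE => /(_ x Bx) /nbhs_sub_cylinder[N xNB].
  by exists N.
apply: (@bigcupT_measurable _ (g_sigma_algebraType (@clopen_set R n))) => N.
apply: sub_sigma_algebra; exists N => x y xy xB z yz.
by apply: xB; exact: agree_trans yz.
Qed.

End clopen_algebra.

Record finitely_additive (R : realType) (T : Type) := FinitelyAdditive {
  fadd :> set T -> R ;
  fadd_ge0 : forall B, 0 <= fadd B ;
  faddU : forall B C, B `&` C = set0 -> fadd (B `|` C) = fadd B + fadd C }.

Definition fadd_content (R : realType) (n : nat)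
    (m : finitely_additive R (Omega R n)) (B : set (clopen_space R n)) : \bar R :=
  (m B)%:E.

Section fadd_content.
Context {R : realType} {n : nat} (m : finitely_additive R (Omega R n)).

Let content_ge0 B : (0 <= fadd_content m B)%E.
Proof. by rewrite lee_fin fadd_ge0. Qed.

Let content_semi_additive : measure_function.semi_additive (fadd_content m).
Proof.
rewrite additive2P.
  by move=> B C _ _ BC; rewrite /fadd_content faddU.
rewrite /fadd_content; congr EFin.
have := @faddU _ _ m set0 set0 (setI0 _); rewrite setU0 => /eqP.
by rewrite -subr_eq subrr => /eqP.
Qed.

HB.instance Definition _ := isContent.Build _ _ _ (fadd_content m)
  content_ge0 content_semi_additive.

(* By compactness a countable clopen cover of a clopen set has a finite subcover,
   so finite subadditivity is enough. *)
Let content_sigma_subadditive :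
  measurable_subset_sigma_subadditive (fadd_content m).
Proof.
move=> B F mF mB BF.
have [k BFk] : exists k, B `<=` \big[setU/set0]_(i < k) F i.
  suff [k Bk] : exists k, B `&` setT `<=` \bigcup_(i < k) F i.
    by exists k; rewrite -bigcup_mkord -(setIT B).
  apply: (@cylinder_compactness R n
    (fun C => exists k, B `&` C `<=` \bigcup_(i < k) F i)).
  - by exists 0%N; rewrite setI0.
  - move=> C D [k Ck] [l Dl]; exists (maxn k l) => x [Bx [Cx|Dx]].
      have [i /= ik Fi] := Ck x (conj Bx Cx); exists i => //=.
      by rewrite leq_max ik.
    have [i /= il Fi] := Dl x (conj Bx Dx); exists i => //=.
    by rewrite leq_max il orbT.
  - move=> x; have [Bx|nBx] := pselect (B x).
      have [i _ Fix_] := BF x Bx; have [N FN] := mF i.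
      by exists N, i.+1 => y [_ xy]; exists i => //=; exact: FN Fix_.
    have [N BN] := mB.
    by exists N, 0%N => y [/(BN _ _ (agree_sym _)) By xy]; case: nBx; exact: By.
have mF' i : (i < k)%N -> measurable (F i) by [].
apply: (le_trans (@content_subadditive _ _ _ (fadd_content m) B F k _ mB BFk)) => //.
rewrite -(big_mkord xpredT (fun i => fadd_content m (F i))).
by apply: nneseries_lim_ge => i _ _; exact: content_ge0.
Qed.

HB.instance Definition _ := Content_SigmaSubAdditive_isMeasure.Build _ R _
  (fadd_content m) content_sigma_subadditive.

Let to_borel (x : g_sigma_algebraType (@clopen_set R n)) : Omega_borel R n := x.

Let measurable_to_borel : measurable_fun setT to_borel.
Proof.
apply: (@measurability _ _ _ (Omega_borel R n) _ _ (@open (Omega R n))) => //.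
move=> _ [B oB <-].
by rewrite setTI; exact: open_sigma_clopen.
Qed.

Context (mT : m setT = 1).

Definition borel_extension : set (Omega_borel R n) -> \bar R :=
  pushforward (measure_extension (fadd_content m)) to_borel.

Let borel_extension_clopen N (B : set (Omega R n)) : clopen_depth N B ->
  borel_extension B = (m B)%:E.
Proof.
by move=> BN; apply: (@measurable_mu_extE _ _ _ (fadd_content m)); exists N.
Qed.

HB.instance Definition _ := Measure.copy borel_extension
  (measure_function_pushforward__canonical__measure_function_Measure
    (measure_extension (fadd_content m)) measurable_to_borel).

HB.instance Definition _ := Measure_isProbability.Build _ _ _ borel_extension
  (etrans (@borel_extension_clopen 0%N setT (fun _ _ _ => id)) (congr1 EFin mT)).

Lemma fadd_extension : exists mu : probability (Omega_borel R n) R,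
  forall N (B : set (Omega R n)), clopen_depth N B -> mu B = (m B)%:E.
Proof. by exists borel_extension. Qed.

End fadd_content.

Section empirical_averages.
Context {R : realType} {T : Type}.
Implicit Types (o : nat -> T) (f g : T -> R).

Definition average o f N : R := N.+1%:R^-1 * \sum_(k < N.+1) f (o k).

Lemma averageD o f g : average o (f \+ g) = average o f + average o g.
Proof. by apply/funext => N; rewrite /average big_split mulrDr. Qed.

Lemma averageB o f g : average o (f \- g) = average o f - average o g.
Proof. by apply/funext => N; rewrite /average sumrB mulrBr. Qed.

Lemma averageZ o a f : average o (fun x => a * f x) = (fun N => a * average o f N).
Proof. by apply/funext => N; rewrite /average -mulr_sumr mulrCA. Qed.

Lemma ler_average o f g : (forall x, f x <= g x) ->
  forall N, average o f N <= average o g N.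
Proof.
by move=> fg N; rewrite ler_wpM2l ?invr_ge0//; apply: ler_sum => k _; exact: fg.
Qed.

Lemma average_cst o a N : average o (fun=> a) N = a.
Proof.
by rewrite /average sumr_const card_ord -[a *+ _]mulr_natl mulKf// pnatr_eq0.
Qed.

End empirical_averages.

Lemma ultra_cvg_compact (T : Type) (S : topologicalType) (U : set_system T)
    (f : T -> S) (K : set S) :
  UltraFilter U -> compact K -> (forall x, K (f x)) -> exists l : S, f @ U --> l.
Proof.
move=> UU cK Kf; have fUK : (f @ U) K by apply: (filterS (F := U)) filterT => x _; exact: Kf.
have [l [_ fUl]] := cK _ (fmap_proper_filter f _) fUK.
exists l => V lV; have [//|UnV] := in_ultra_setVsetC (f @^-1` V) UU.
by have [x []] := fUl (~` V) V UnV lV.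
Qed.

Section limit_content.
Context {R : realType} {T : Type} (U : set_system nat) {UU : UltraFilter U}.
Context (o : nat -> T).

Let is_cvg_average_indic (B : set T) : cvg (average o (\1_B : T -> R) @ U).
Proof.
apply/cvg_ex; apply: (ultra_cvg_compact _ (@segment_compact R 0 1)) => N.
rewrite /= in_itv/= -{1}(average_cst o 0 N) -(average_cst o 1 N).
by rewrite !ler_average// => x; rewrite indicE; case: (x \in B).
Qed.

Definition limit_frequency (B : set T) : R := lim (average o \1_B @ U).

Let limit_frequency_ge0 B : 0 <= limit_frequency B.
Proof.
apply: limr_ge => //; apply: nearW => N.
by rewrite -(average_cst o 0 N) ler_average// => x; rewrite indicE.
Qed.

Let limit_frequencyU B C : B `&` C = set0 ->
  limit_frequency (B `|` C) = limit_frequency B + limit_frequency C.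
Proof.
move=> BC; rewrite /limit_frequency -limD//; congr (lim (_ @ U)).
rewrite -averageD; congr average; apply/funext => x /=.
rewrite !indicE in_setU; case: (boolP (x \in B)) => xB; last by rewrite add0r.
case: (boolP (x \in C)) => xC; last by rewrite addr0.
by have : (B `&` C) x; [split; exact: set_mem|rewrite BC].
Qed.

Definition limit_content : finitely_additive R T :=
  FinitelyAdditive limit_frequency_ge0 limit_frequencyU.

Lemma limit_contentT : limit_content setT = 1.
Proof.
apply/cvg_lim => //; rewrite (_ : average o _ = cst 1); first exact: cvg_cst.
by apply/funext => N; rewrite -[RHS](average_cst o 1 N) indicT.
Qed.

Lemma cvg_limit_content B : average o \1_B @ U --> (limit_content B : R).
Proof. exact: is_cvg_average_indic. Qed.

End limit_content.

Lemma cvg_average_coboundary (R : realType) (T : Type) (o : nat -> T)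
    (f h : T -> R) (c M : R) : (forall x, `|h x| <= M) ->
    (forall k, f (o k.+1) = c + h (o k) - h (o k.+1)) ->
  average o f @ \oo --> c.
Proof.
move=> hM fh; pose r N : R := f (o 0%N) - c + h (o 0%N) - h (o N).
have sumE N : \sum_(k < N.+1) f (o k) = N.+1%:R * c + r N.
  elim: N => [|N IH]; first by rewrite big_ord1 /r mul1r; ring.
  by rewrite big_ord_recr/= IH fh /r -(natr1 N.+1); ring.
have -> : average o f = (fun=> c) + (fun N => N.+1%:R^-1 * r N).
  apply/funext => N; rewrite /average sumE mulrDr mulKf ?pnatr_eq0//.
rewrite -[X in _ --> X]addr0; apply: cvgD; first exact: cvg_cst.
apply: norm_cvg0; pose K := `|f (o 0%N) - c + h (o 0%N)| + M.
apply: (@squeeze_cvgr _ _ _ _ (fun=> 0) (fun N => harmonic N * K)).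
- apply: nearW => N; rewrite normr_ge0/= normrM ger0_norm ?invr_ge0//.
  by rewrite ler_wpM2l ?invr_ge0// (le_trans (ler_normB _ _))// lerD2l.
- exact: cvg_cst.
- by rewrite -(mul0r K); apply: cvgMl; exact: cvg_harmonic.
Qed.

Section continuous_functions.
Context {R : realType} {n : nat}.
Implicit Types (f : Omega R n -> R).

Lemma continuous_Omega_bounded f : continuous f -> exists M, forall x, `|f x| <= M.
Proof.
move=> fC; suff [M fM] : exists M, forall x, setT x -> `|f x| <= M.
  by exists M => x; exact: fM.
apply: (cylinder_compactness (good := fun B => exists M, forall x, B x -> `|f x| <= M)).
- by exists 0.
- move=> B C [M BM] [N CN]; exists (Num.max M N) => x.
  by rewrite le_max => -[/BM ->//|/CN ->]; rewrite orbT.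
- move=> x; have /cvgrPdist_le/(_ 1 ltr01)/nbhs_sub_cylinder[N xN] := fC x.
  exists N, (`|f x| + 1) => y /xN /=.
  by rewrite distrC => /(le_trans (lerB_dist _ _)); rewrite lerBlDl.
Qed.

Lemma continuous_Omega_unif f : continuous f -> forall e : R, 0 < e ->
  exists N, forall x y, agree N x y -> `|f x - f y| <= e.
Proof.
move=> fC e e0.
suff [N fN] : exists N, forall x, setT x -> forall y, agree N x y -> `|f x - f y| <= e.
  by exists N => x; exact: fN.
apply: (cylinder_compactness (good := fun B => exists N, forall x, B x ->
  forall y, agree N x y -> `|f x - f y| <= e)).
- by exists 0%N.
- move=> B C [M BM] [N CN]; exists (maxn M N) => x [Bx|Cx] y xy.
    by apply: BM => //; apply: agreeW xy; exact: leq_maxl.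
  by apply: CN => //; apply: agreeW xy; exact: leq_maxr.
- move=> x.
  have /cvgrPdist_le/(_ _ (divr_gt0 e0 (ltr0n R 2)))/nbhs_sub_cylinder[N xN] := fC x.
  exists N, N => y xy z yz; have := xN y xy; have := xN z (agree_trans xy yz).
  by rewrite /= !ler_norml; lra.
Qed.

Lemma continuous_Omega_measurable f : continuous f ->
  measurable_fun setT (f : Omega_borel R n -> R).
Proof.
move=> /continuousP fC; apply: (measurability _ (measurable_realfun.RGenOpens.measurableE R)).
move=> _ [_ [a [b ->]] <-]; rewrite setTI; apply: sub_sigma_algebra; apply: fC.
exact: interval_open.
Qed.

End continuous_functions.

Section limit_measure.
Context {R : realType} {n : nat} (U : set_system nat) {UU : UltraFilter U}.
Context (o : nat -> Omega R n) (mu : probability (Omega_borel R n) R).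
Context (mu_clopen : forall N (B : set (Omega R n)), clopen_depth N B ->
  average o \1_B @ U --> fine (mu B)).
Implicit Types (f g : Omega R n -> R) (B : set (Omega R n)).

Lemma clopen_depth_measurable N B : clopen_depth N B ->
  measurable (B : set (Omega_borel R n)).
Proof. by move=> /open_clopen_depth; exact: sub_sigma_algebra. Qed.

(* The averages are those along [o], and their limit is taken along [U]. *)
Definition equidistributed f := mu.-integrable setT (EFin \o f) /\
  average o f @ U --> (\int[mu]_x f x)%R.

Lemma equidistributed0 : equidistributed (fun=> 0).
Proof.
split; first exact: integrable0.
rewrite Rintegral_cst// mul0r (_ : average o _ = cst 0); first exact: cvg_cst.
by apply/funext => N; exact: average_cst.
Qed.

Lemma equidistributedD f g : equidistributed f -> equidistributed g ->
  equidistributed (f \+ g).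
Proof.
move=> [fi fU] [gi gU]; split; first exact: (integrableD measurableT fi gi).
by rewrite RintegralD// averageD; exact: cvgD.
Qed.

Lemma equidistributedZ a f : equidistributed f ->
  equidistributed (fun x => a * f x).
Proof.
move=> [fi fU]; split; first exact: (integrableZl measurableT a fi).
by rewrite RintegralZl// averageZ; exact: cvgMr.
Qed.

Lemma equidistributed_clopen N B : clopen_depth N B ->
  equidistributed (\1_B : Omega R n -> R).
Proof.
move=> BN; have mB := clopen_depth_measurable BN; split.
  exact: integrable_indic.
by rewrite /Rintegral integral_indic// setIT; exact: mu_clopen BN.
Qed.

Lemma equidistributed_depth N f : (forall x y, agree N x y -> f x = f y) ->
  equidistributed f.
Proof.
move=> fN.
pose ext (w : {ffun 'I_N -> 'I_n.+1}) : Omega R n :=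
  fun i => if insub i is Some j then w j else ord0.
have extP (x : Omega R n) : agree N (ext [ffun i : 'I_N => x i]) x.
  by move=> i iN; rewrite /ext insubT ffunE.
have -> : f = (fun x => \sum_w f (ext w) * \1_(cylinder (ext w) N) x).
  apply/funext => x; rewrite (bigD1 [ffun i : 'I_N => x i])//= big1 => [|w wx].
    by by rewrite indicE (mem_set (extP x)) mulr1 addr0; exact/esym/fN.
  rewrite indicE memNset ?mulr0// => wx'; move/eqP: wx; apply.
  apply/ffunP => i; rewrite ffunE -wx'//= /ext; by rewrite valK.
rewrite [X in equidistributed X](_ : _ = \sum_w
    (fun x => f (ext w) * \1_(cylinder (ext w) N) x)); last first.
  by apply/funext => x; rewrite fct_sumE.
elim/big_ind: _ => [|g h|w _]; first exact: equidistributed0.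
  exact: equidistributedD.
apply: (@equidistributedZ (f (ext w))).
exact: equidistributed_clopen (@clopen_depth_cylinder _ _ _ _).
Qed.

Lemma equidistributed_lim f : mu.-integrable setT (EFin \o f) ->
    (forall e : R, 0 < e -> exists2 g, equidistributed g & forall x, `|f x - g x| <= e) ->
  equidistributed f.
Proof.
move=> fi fg; split => //; apply/cvgrPdist_le => e e0.
have [g [gi gU] gf] := fg (e / 3) (divr_gt0 e0 (ltr0n _ 3)).
have /cvgrPdist_le/(_ _ (divr_gt0 e0 (ltr0n R 3))) := gU.
apply: filterS => N.
have ci a : mu.-integrable setT (EFin \o (fun=> a : R)).
  exact: (finite_measure_integrable_cst mu a measurableT).
have int_cst a : (\int[mu]_x (fun=> a : R) x = a)%R.
  rewrite Rintegral_cst; last exact: measurableT.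
  by rewrite [fine _](congr1 fine (probability_setT mu)) mulr1.
have fgi : (\int[mu]_x f x <= \int[mu]_x g x + e / 3)%R.
  rewrite -[X in _ + X](int_cst (e / 3)) -RintegralD//.
  apply: le_Rintegral => //; first exact: (integrableD measurableT gi (ci _)).
  by move=> x _; have := gf x; rewrite ler_norml; lra.
have gfi : (\int[mu]_x g x <= \int[mu]_x f x + e / 3)%R.
  rewrite -[X in _ + X](int_cst (e / 3)) -RintegralD//.
  apply: le_Rintegral => //; first exact: (integrableD measurableT fi (ci _)).
  by move=> x _; have := gf x; rewrite ler_norml; lra.
have fga : average o f N <= average o g N + e / 3.
  rewrite -(average_cst o (e / 3) N) -[leRHS]/((average o g + average o _) N) -averageD.
  by apply: ler_average => x; have := gf x; rewrite ler_norml /=; lra.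
have gfa : average o g N <= average o f N + e / 3.
  rewrite -(average_cst o (e / 3) N) -[leRHS]/((average o f + average o _) N) -averageD.
  by apply: ler_average => x; have := gf x; rewrite ler_norml /=; lra.
by rewrite !ler_norml; lra.
Qed.

Lemma equidistributed_continuous f : continuous f -> equidistributed f.
Proof.
move=> fC; apply: equidistributed_lim.
  apply: measurable_bounded_integrable => //.
  - exact: (le_lt_trans (probability_le1 mu measurableT) (ltry _)).
  - exact: continuous_Omega_measurable.
  - have [M fM] := continuous_Omega_bounded fC.
    exists M; split; first exact: num_real.
    by move=> r Mr x _; exact: le_trans (fM x) (ltW Mr).
move=> e /(continuous_Omega_unif fC)[N fN].
pose trunc (x : Omega R n) : Omega R n := fun i => if (i < N)%N then x i else ord0.
have truncP x : agree N x (trunc x) by move=> i iN; rewrite /trunc iN.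
exists (f \o trunc); last by move=> x; exact: fN.
apply: (@equidistributed_depth N) => x y xy /=; congr f; apply/funext => i.
by rewrite /trunc; case: ifP => // /xy.
Qed.

Lemma limit_measure_invariant :
  \oo `<=` U -> (forall k, Omega_shift (o k.+1) = o k) -> shift_invariant mu.
Proof.
move=> ooU so B mB.
pose G : set (set (Omega_borel R n)) := @clopen_set R n.
have GE : measurable = <<s G >>.
  apply/seteqP; split; apply: smallest_sub; try exact: smallest_sigma_algebra.
    exact: open_sigma_clopen.
  by move=> C [N CN]; apply: sub_sigma_algebra; exact: open_clopen_depth CN.
have mshift : measurable_fun setT (@Omega_shift R n : Omega_borel R n -> Omega_borel R n).
  apply: (measurability _ GE) => _ [C [N CN] <-]; rewrite setTI.
  apply: (@clopen_depth_measurable N.+1) => x y xy /=.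
  by apply: CN => i iN; exact: xy.
apply: (@measure_unique _ _ _ G (fun=> setT) GE _ _ _
  (measure_function_pushforward__canonical__measure_function_Measure mu mshift) mu) => //.
- move=> C D [M CM] [N DN]; exists (maxn M N).
  apply: clopen_depthI; [apply: clopen_depthW CM; exact: leq_maxl|
                         apply: clopen_depthW DN; exact: leq_maxr].
- by move=> _; exists 0%N.
- by rewrite bigcup_const.
- move=> C [N CN].
  have CN1 : clopen_depth N.+1 (@Omega_shift R n @^-1` C).
    by move=> x y xy; apply: CN => i iN; exact: xy.
  have cC := mu_clopen CN; have cC1 := mu_clopen CN1.
  have muE N' (D : set (Omega R n)) : clopen_depth N' D -> mu D = (fine (mu D))%:E.
    move=> /clopen_depth_measurable mD; rewrite fineK//.
    exact: (fin_num_measure mu _ mD).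
  suff muC : fine (mu (@Omega_shift R n @^-1` C)) = fine (mu C).
    by apply: (etrans (muE _ _ CN1)); rewrite muC -(muE _ _ CN).
  have c0 : average o (\1_(@Omega_shift R n @^-1` C) \- \1_C) @ U --> (0 : R).
    apply: cvg_trans (@cvg_average_coboundary _ _ o _ \1_C 0 1 _ _).
    + by move=> V; exact: ooU.
    + by move=> x; rewrite indicE ger0_norm//; case: (x \in C).
    + by move=> k; rewrite /= !indicE -[_ \in _ @^-1` _]/(Omega_shift (o k.+1) \in C) so add0r.
  apply/eqP; rewrite -subr_eq0; apply/eqP; apply: norm_cvg_unique c0.
  by rewrite /= averageB; exact: cvgB.
- by move=> _; exact: (le_lt_trans (probability_le1 mu measurableT) (ltry _)).
Qed.
End limit_measure.

Section calibrated_orbits.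
Context {R : realType} {n : nat} (A u : Omega R n -> R).
Context (lipA : lipschitz_continuous A) (subu : calibrated_subaction A u).

Lemma lipschitz_continuous_continuous : continuous A.
Proof.
have [k Ak] := lipA; move=> x; apply/(cvgrPdist_le (FF := nbhs_filter x)) => e e0.
have [N Ne] := exp2V_lt (divr_gt0 e0 (ltr_pwDr ltr01 (normr_ge0 k))).
apply: (@filterS _ (nbhs x) _ _ _ _ (nbhs_cylinder x N.+1)) => y /agree_mdist xy.
rewrite (le_trans (Ak x y))//.
have k1 : 0 < `|k| + 1 by rewrite ltr_pwDr.
have := ler_norm k; have := mdist_ge0 x y.
move: (lt_trans xy Ne); rewrite ltr_pdivlMr//; nra.
Qed.

(* The orbit runs backwards: [o k.+1] is a preimage of [o k]. *)
Definition calibrated_orbit (o : nat -> Omega R n) := forall k,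
  Omega_shift (o k.+1) = o k /\
  u (o k) = A (o k.+1) + u (o k.+1) - max_integral A.

Lemma exists_calibrated_orbit x : exists2 o, calibrated_orbit o & o 0%N = x.
Proof.
have pre y : exists z, Omega_shift z = y /\ A z + u z - max_integral A = u y.
  by have [[z zy uz] _] := subu.2 y; exists z.
pose p y := projT1 (cid (pre y)).
exists (fun k => iter k p x) => // k /=.
by have [-> ->] := projT2 (cid (pre (iter k p x))).
Qed.

Lemma calibrated_orbit_visits o p (uniqA : unique_maximizing A) : calibrated_orbit o ->
  forall mu, maximizing A mu -> forall N, (0 < mu (cylinder p N))%E ->
  exists k, cylinder p N (o k).
Proof.
move=> co mu maxmu N; rewrite lt_neqAle => /andP[/eqP mu0 _].
apply: contrapT => /forallNP onp; apply: mu0.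
have [U [UU ooU]] := ultraFilterLemma (eventually_filter).
have [nu nuE] := fadd_extension (@limit_contentT R _ U UU o).
have nu_clopen L (B : set (Omega R n)) : clopen_depth L B ->
    average o \1_B @ U --> fine (nu B).
  by move=> BL; rewrite (nuE _ _ BL); exact: (@cvg_limit_content R _ U UU o).
have maxnu : maximizing A nu.
  split.
    by apply: limit_measure_invariant nu_clopen ooU _ => k; have [] := co k.
  have [_ AU] := equidistributed_continuous nu_clopen lipschitz_continuous_continuous.
  apply: (norm_cvg_unique AU).
  have [M uM] := continuous_Omega_bounded subu.1.
  apply: cvg_trans (cvg_average_coboundary (f := A) uM _).
    by move=> V; exact: ooU.
  by move=> k; rewrite (proj2 (co k)); ring.
have [mu' _ mu'E] := uniqA.
have mC := clopen_depth_measurable (@clopen_depth_cylinder R n p N).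
rewrite (mu'E _ maxmu _ mC) -(mu'E _ maxnu _ mC).
rewrite (nuE _ _ (@clopen_depth_cylinder _ _ p N)); congr EFin.
apply: norm_cvg_unique (@cvg_limit_content R _ U UU o _).
rewrite /= (_ : average _ _ = cst 0); first exact: cvg_cst.
apply/funext => L; rewrite /average big1 ?mulr0// => k _.
by rewrite indicE memNset//; exact: onp.
Qed.

End calibrated_orbits.

Lemma exists_support_point (R : realType) (n : nat)
    (mu : probability (Omega_borel R n) R) :
  exists p, forall N, (0 < mu (cylinder p N))%E.
Proof.
apply: contrapT => /forallNP nop.
have : measurable (setT : set (Omega_borel R n)) /\ mu setT = 0%E.
  apply: (cylinder_compactness (good := fun B : set (Omega R n) =>
    measurable (B : set (Omega_borel R n)) /\ mu B = 0%E)).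
  - by split => //; exact: measure0.
  - move=> B C [mB B0] [mC C0]; split; first exact: measurableU.
    exact: (etrans (measureU0 mB mC C0) B0).
  - move=> x; have /existsNP[N nN] := nop x; exists N.
    have mx := clopen_depth_measurable (@clopen_depth_cylinder R n x N).
    split => //; apply/eqP; rewrite -measure_le0 leNgt; exact/negP.
by move=> [_]; rewrite probability_setT => /eqP; rewrite onee_eq0.
Qed.

Lemma calibrated_subaction_sub_le (R : realType) (n : nat) (A u v : Omega R n -> R)
    (mu : probability (Omega_borel R n) R) p :
  lipschitz_continuous A -> unique_maximizing A -> maximizing A mu ->
  (forall N, (0 < mu (cylinder p N))%E) ->
  calibrated_subaction A u -> calibrated_subaction A v ->
  forall x, u x - v x <= u p - v p.
Proof.
move=> lipA uniqA maxmu mup subu subv x.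
case: (exists_calibrated_orbit subu x) => o co <-.
have mono k : u (o 0%N) - v (o 0%N) <= u (o k) - v (o k).
  elim: k => // k IH; apply: (le_trans IH); have [so uo] := co k.
  have [_ /(_ (A (o k.+1) + v (o k.+1) - max_integral A))] := subv.2 (o k).
  have h : [set A y + v y - max_integral A | y in [set y | Omega_shift y = o k]]
      (A (o k.+1) + v (o k.+1) - max_integral A) by exists (o k.+1).
  by move=> /(_ h); rewrite uo; lra.
apply/ler_addgt0Pr => e e0.
have cw : continuous (u \- v).
  by move=> y; exact: (cvgB (FF := nbhs_filter y) (subu.1 y) (subv.1 y)).
have /cvgrPdist_le/(_ _ e0)/nbhs_sub_cylinder[N pN] := cw p.
have [k /pN/=] := calibrated_orbit_visits lipA subu uniqA co maxmu (mup N).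
by have := mono k; rewrite ler_norml; lra.
Qed.

Theorem theorem4p9 (R : realType) (n : nat) (A : Omega R n -> R)
    (lipA : lipschitz_continuous A) (uniqA : unique_maximizing A)
    (u v : Omega R n -> R) (subu : calibrated_subaction A u)
    (subv : calibrated_subaction A v) :
  exists c : R, forall x : Omega R n, u x = v x + c.
Proof.
have [mu maxmu _] := uniqA.
have [p mup] := exists_support_point mu.
exists (u p - v p) => x.
have := calibrated_subaction_sub_le lipA uniqA maxmu mup subu subv x.
have := calibrated_subaction_sub_le lipA uniqA maxmu mup subv subu x.
lra.
Qed.
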